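(* Let $M^*$ be the (unknown) true MDP, let $\delta_{\mathbb I}\in[0,1]$ be a confidence level, let $\theta\in[0,1]$ be a feasible threshold, and let $A_{\mathrm{sh}}$ be the $\theta$-shield computed from the interval MDP $\hat M_{\mathbb I}$ that is estimated from a dataset $\mathcal D$ with confidence parameter $\delta_{\mathbb I}$. Then, conditioned on the dataset $\mathcal D$, the $\theta$-shield $A_{\mathrm{sh}}$ solely maps to $\theta$-safe actions on the true MDP $M^*$ with probability at least $1-\delta_{\mathbb I}$. Formally, starting from any state $s\in S$, the probability that the shielded action $a\in A_{\mathrm{sh}}(s)$ is also $\theta$-safe on the true MDP $M^*$ satisfies $$\Pr\Big(\mathbb Q^*_{M^*}(s,a)\ \ge\ 1-\theta\Big)\ \ge\ 1-\delta_{\mathbb I}.$$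
   Context: MDP: a tuple $M=(S,s_0,A,T,R,\gamma)$ with finite state set $S$, initial state $s_0\in S$, finite action set $A$ (with $A(s)\subseteq A$ the actions available at $s$), a partial transition function assigning to $s\in S$ and an available action $a$ a probability distribution $T(\cdot\mid s,a)$ on $S$, bounded reward $R:S\times A\to\mathbb R$, and $\gamma\in[0,1)$. A (stochastic memoryless) policy is a map $\pi:S\to\Delta(A)$; $\Pi$ is the set of policies. Interval MDP (IMDP): like an MDP, but the transition function $T_{\mathbb I}$ assigns to each transition $(s,a,s')$ either the value $0$ (the transition does not exist) or an interval $[l,u]$ with $0<l<u\le 1$. $M\in M_{\mathbb I}$ means that the transition probabilities of the MDP $M$ lie in the intervals (or equal the zeros) of $M_{\mathbb I}$, everything else being the same. Estimated IMDP: $\mathcal D$ is a finite collection of trajectories of $M^*$, and $N_{\mathcal D}(s,a)$ is the number of occurrences of $(s,a)$ in it. It is assumed known which transitions of $M^*$ have positive probability. $\hat T(s'\mid s,a)$ is a point estimate of the transition probability (the mode of the Dirichlet posterior given the observed transition counts). Put $\delta_T=\delta_{\mathbb I}/\sum_{s,a}|\mathrm{supp}(T(s,a))|$, where $|\mathrm{supp}(T(s,a))|$ is the number of successor states of $(s,a)$, and $\eta_T=\sqrt{\log(2/\delta_T)/(2N_{\mathcal D}(s,a))}$. For a small constant $\xi\in(0,1)$, every existing transition gets the interval $\hat T_{\mathbb I}(s'\mid s,a)=[\max(\xi,\hat T(s'\mid s,a)-\eta_T),\ \min(\hat T(s'\mid s,a)+\eta_T,1)]$. The resulting IMDP is $\hat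 M_{\mathbb I}$; its guarantee, obtained from Hoeffding's inequality and a union bound, is $\Pr(M^*\in\hat M_{\mathbb I})\ge 1-\delta_{\mathbb I}$. The probability $\Pr$ in the claim is the one in this guarantee. Reach-avoid: fixed disjoint sets $S_T\subset S$ (target) and $S_U\subset S$ (unsafe). For an MDP $M$, $\pi\in\Pi$, $s\in S$, $\mathbb P_M^{\pi,\varphi}(s)$ is the probability, starting in $s$ and following $\pi$ in $M$, of reaching $S_T$ without visiting $S_U$ before. For an MDP $M$, $\mathbb V^*_M(s)=\max_{\pi\in\Pi}\mathbb P_M^{\pi,\varphi}(s)$, and $\mathbb Q^*_M(s,a)=\sum_{s'}T(s'\mid s,a)\,\mathbb V_M^*(s')$ for $s\notin S_T\cup S_U$. For the IMDP, $\mathbb V_{\hat M_{\mathbb I}}(s)=1$ if $s\in S_T$, $\mathbb V_{\hat M_{\mathbb I}}(s)=0$ if $s\in S_U$, and for $s\in S\setminus(S_T\cup S_U)$ $$\mathbb V_{\hat M_{\mathbb I}}(s)=\max_{a\in A}\mathbb Q_{\hat M_{\mathbb I}}(s,a),\qquad \mathbb Q_{\hat M_{\mathbb I}}(s,a)=\inf_{\underline T(s,a)\in \hat T_{\mathbb I}(s,a)\cap\Delta(S)}\sum_{s'\in S}\underline T(s'\mid s,a)\,\mathbb V_{\hat M_{\mathbb I}}(s'),$$ where $\hat T_{\mathbb I}(s,a)\cap\Delta(S)$ is the set of distributions on $S$ respecting the intervals (and zeros) at $(s,a)$. $\mathbb V^*_{\hat M_{\mathbb I}},\mathbb Q^*_{\hat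 M_{\mathbb I}}$ are the fixed points of these equations representing the optimal worst-case reach-avoid probabilities, so $\mathbb V^*_{\hat M_{\mathbb I}}(s)=\max_{\pi\in\Pi}\min_{M\in\hat M_{\mathbb I}}\mathbb P_M^{\pi,\varphi}(s)$. $\theta$-safety and shield: an action $a$ is $\theta$-safe at $s$ (in the IMDP) if $\mathbb Q^*_{\hat M_{\mathbb I}}(s,a)>1-\theta$. The $\theta$-shield is $A_{\mathrm{sh}}(s)=\{a\in A\mid \mathbb Q^*_{\hat M_{\mathbb I}}(s,a)>1-\theta\}$. The threshold $\theta$ is feasible if for all $s\in S$ there is $a\in A$ with $\mathbb Q^*_{\hat M_{\mathbb I}}(s,a)>1-\theta$. Being $\theta$-safe on the true MDP means the inequality $\mathbb Q^*_{M^*}(s,a)\ge 1-\theta$ displayed in the claim. *)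

(* Defs.v *)
(* MathComp + MathComp-Analysis. *)
From HB Require Import structures.
From mathcomp Require Import all_boot all_order all_algebra.
From mathcomp Require Import all_classical all_reals all_analysis.

Set Implicit Arguments.
Unset Strict Implicit.
Unset Printing Implicit Defensive.

Import Order.TTheory GRing.Theory Num.Theory.
Import numFieldNormedType.Exports.

Local Open Scope classical_set_scope.
Local Open Scope ring_scope.

(* An MDP is split into its frame, i.e. everything except the numerical values
   of the transition probabilities (in particular which transitions exist), and
   the transition function itself. MDPs over one frame differ only in the
   probabilities of existing transitions, and an interval MDP over that frame
   prescribes intervals for exactly those. *)
Record mdp_frame (R : realType) (S A : finType) := MDPFrame {
  init : S;
  avail : S -> {set A};
  succ : S -> A -> {set S};
  reward : S -> A -> R;
  discount : R;
  avail_neq0 : forall s, avail s != finset.set0;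
  discount_ge0 : 0 <= discount;
  discount_lt1 : discount < 1 }.

(* The transition function is partial: [trans s a] is meaningful only if
   [a \in avail K s]. *)
Record mdp (R : realType) (S A : finType) (K : mdp_frame R S A) := MDP {
  trans : S -> A -> S -> R;
  trans_ge0 : forall s a s', a \in avail K s -> 0 <= trans s a s';
  trans_sum1 : forall s a, a \in avail K s -> \sum_s' trans s a s' = 1;
  trans_succ : forall s a s', a \in avail K s ->
    (0 < trans s a s') = (s' \in succ K s a) }.

(* The transition [(s, a, s')] carries the interval [[lo s a s', up s a s']] if
   [s' \in succ K s a], and the value 0 otherwise. *)
Record imdp (R : realType) (S A : finType) (K : mdp_frame R S A) := IMDP {
  lo : S -> A -> S -> R;
  up : S -> A -> S -> R }.

Record policy (R : realType) (S A : finType) (K : mdp_frame R S A) := Policy {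
  pol : S -> A -> R;
  pol_ge0 : forall s a, 0 <= pol s a;
  pol_sum1 : forall s, \sum_a pol s a = 1;
  pol_avail : forall s a, a \notin avail K s -> pol s a = 0 }.

Definition dist_on (R : realType) (S : finType) (X : {set S}) (p : S -> R) :=
  [/\ forall s', 0 <= p s', \sum_s' p s' = 1 &
      forall s', s' \notin X -> p s' = 0].

Section Reachability.
Context {R : realType} {S A : finType} {K : mdp_frame R S A}.
Variables (ST SU : {set S}).

Definition step (M : mdp K) (pi : policy K) (s s' : S) : R :=
  \sum_(a in avail K s) pol pi s a * trans M s a s'.

Fixpoint path_prob (M : mdp K) (pi : policy K) (s : S) (p : seq S) : R :=
  if p is s' :: p' then step M pi s s' * path_prob M pi s' p' else 1.

(* Some state of the path is a target and no earlier state is unsafe. *)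
Fixpoint reach_avoid_path (p : seq S) : bool :=
  if p is s :: p' then (s \in ST) || ((s \notin SU) && reach_avoid_path p')
  else false.

Definition reach_avoid_within (M : mdp K) (pi : policy K) (n : nat) (s : S) : R :=
  \sum_(t : n.-tuple S | reach_avoid_path (s :: t)) path_prob M pi s t.

(* The unbounded event is the increasing union over [n] of the events of
   occurrence within [n] steps, which are unions of cylinders. *)
Definition reach_avoid (M : mdp K) (pi : policy K) (s : S) : R :=
  sup (range (fun n => reach_avoid_within M pi n s)).

Definition mdp_V (M : mdp K) (s : S) : R :=
  sup (range (fun pi : policy K => reach_avoid M pi s)).

(* The Q-functions, here and for interval MDPs, are given by the one-step
   formula at every state, target and unsafe states included. *)
Definition mdp_Q (M : mdp K) (s : S) (a : A) : R :=
  \sum_s' trans M s a s' * mdp_V M s'.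

Definition in_imdp (MI : imdp K) (M : mdp K) : Prop :=
  forall s a s', a \in avail K s -> s' \in succ K s a ->
    lo MI s a s' <= trans M s a s' <= up MI s a s'.

Definition imdp_dist (MI : imdp K) (s : S) (a : A) : set (S -> R) :=
  [set p | dist_on (succ K s a) p /\
    forall s', s' \in succ K s a -> lo MI s a s' <= p s' <= up MI s a s'].

Definition imdp_Q (MI : imdp K) (V : S -> R) (s : S) (a : A) : R :=
  inf [set \sum_s' p s' * V s' | p in imdp_dist MI s a].

(* [V] solves the robust Bellman equations and is the solution representing
   the optimal worst-case reach-avoid probabilities. The first three clauses
   alone need not determine [V]. *)
Definition imdp_V_spec (MI : imdp K) (V : S -> R) : Prop :=
  [/\ forall s, s \in ST -> V s = 1,
      forall s, s \in SU -> V s = 0,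
      forall s, s \notin ST -> s \notin SU ->
        V s = sup [set imdp_Q MI V s a | a in [set a | a \in avail K s]] &
      forall s, V s =
        sup (range (fun pi : policy K =>
          inf [set reach_avoid M pi s | M in in_imdp MI]))].

Definition shield (MI : imdp K) (V : S -> R) (theta : R) (s : S) : {set A} :=
  [set a in avail K s | 1 - theta < imdp_Q MI V s a]%SET.

(* Required only off the target and unsafe states: an absorbing unsafe state,
   say, has one-step value 0, so that no threshold would be feasible there. *)
Definition feasible (MI : imdp K) (V : S -> R) (theta : R) : Prop :=
  forall s, s \notin ST -> s \notin SU ->
    exists2 a, a \in avail K s & 1 - theta < imdp_Q MI V s a.

End Reachability.

(* The trajectory s0 a0 s1 a1 ... sn is encoded as
   [(s0, [:: (a0, s1); ...; (a(n-1), sn)])]. *)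
Definition trajectory (S A : finType) := (S * seq (A * S))%type.
Definition dataset (S A : finType) := seq (trajectory S A).

Fixpoint steps (S A : finType) (s : S) (p : seq (A * S)) : seq (S * A * S) :=
  if p is (a, s') :: p' then (s, a, s') :: steps s' p' else [::].

Definition data_steps (S A : finType) (D : dataset S A) : seq (S * A * S) :=
  flatten [seq steps tau.1 tau.2 | tau <- D].

Definition count_sas (S A : finType) (D : dataset S A) s a s' : nat :=
  count_mem (s, a, s') (data_steps D).

Definition count_sa (S A : finType) (D : dataset S A) s a : nat :=
  count_mem (s, a) [seq x.1 | x <- data_steps D].

(* Trajectories of an MDP over [K]: only available actions are taken and only
   transitions of positive probability occur. *)
Definition data_valid (R : realType) (S A : finType) (K : mdp_frame R S A)
    (D : dataset S A) : bool :=
  all (fun x : S * A * S =>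
         (x.1.2 \in avail K x.1.1) && (x.2 \in succ K x.1.1 x.1.2))
      (data_steps D).

(* Density of the Dirichlet distribution with parameters [beta] on the simplex
   over [X], up to its normalising constant. *)
Definition dirichlet_kernel (R : realType) (S : finType) (X : {set S})
    (beta p : S -> R) : R :=
  \prod_(s' in X) p s' `^ (beta s' - 1).

Definition dirichlet_mode (R : realType) (S : finType) (X : {set S})
    (beta p : S -> R) : Prop :=
  dist_on X p /\
  forall q, dist_on X q -> dirichlet_kernel X beta q <= dirichlet_kernel X beta p.

(* Posterior parameters of the transition distributions: prior parameter plus
   number of observations. *)
Definition posterior (R : realType) (S A : finType) (alpha : S -> A -> S -> R)
    (D : dataset S A) s a s' : R :=
  alpha s a s' + (count_sas D s a s')%:R.

Section Estimation.
Context {R : realType} {S A : finType}.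
Variables (K : mdp_frame R S A) (deltaI xi : R).

Definition delta_T : R :=
  deltaI / (\sum_s \sum_(a in avail K s) #|succ K s a|)%:R.

(* Infinite when [(s, a)] is unobserved or no failure probability is allowed. *)
Definition eta_T (D : dataset S A) s a : \bar R :=
  if (count_sa D s a == 0%N) || (deltaI == 0) then +oo%E
  else (Num.sqrt (ln (2 / delta_T) / (2 * (count_sa D s a)%:R)))%:E.

(* [That] is the point estimate of the transition function. The bounds are
   finite, since [xi] and 1 are. *)
Definition est_imdp (That : S -> A -> S -> R) (D : dataset S A) : imdp K :=
  IMDP K
    (fun s a s' => fine (maxe xi%:E ((That s a s')%:E - eta_T D s a)%E))
    (fun s a s' => fine (mine ((That s a s')%:E + eta_T D s a)%E 1%:E)).

End Estimation.

(* Main.v *)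
(* If the true MDP lies in the interval MDP, then nature's worst case is at
   least as bad as the true MDP under every policy, so V <= V*_{M*}; as the true
   transition distribution is also admissible in the infimum defining Q, this
   gives Q <= Q*_{M*}, and every shielded action is safe. It remains to compare
   probabilities, which needs the events to be measurable: V*_{M*} is a supremum
   over uncountably many policies, but for a fixed horizon the reach-avoid
   probability is continuous in the policy, so a countable family of policies
   with rational weights suffices. *)
Require Import Defs.
From HB Require Import structures.
From mathcomp Require Import all_boot all_order all_algebra.
From mathcomp Require Import all_classical all_reals all_analysis.
From mathcomp Require Import measurable_realfun.
Import Order.TTheory GRing.Theory Num.Theory.
Import numFieldNormedType.Exports.
Local Open Scope classical_set_scope.
Local Open Scope ring_scope.

(** * Finite sums: recursion over tuples, limits, measurability *)

Lemma big_tuple_cons (V : nmodType) (T : finType) n (F : seq T -> V) :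
  \sum_(t : n.+1.-tuple T) F t = \sum_x \sum_(t : n.-tuple T) F (x :: t).
Proof.
rewrite pair_big /=.
rewrite (reindex (fun p : T * n.-tuple T => [tuple of p.1 :: p.2])) //=.
exists (fun t : n.+1.-tuple T => (thead t, [tuple of behead t]))
  => [[x t] _|t _].
  by congr pair; exact: val_inj.
by rewrite /= -tuple_eta.
Qed.

Lemma cvg_sum_cond (R : realType) (I : Type) (r : seq I) (P : pred I)
    (f : I -> nat -> R) (l : I -> R) :
  (forall i, P i -> f i n @[n --> \oo] --> l i) ->
  \sum_(i <- r | P i) f i n @[n --> \oo] --> \sum_(i <- r | P i) l i.
Proof. by apply: cvg_big; exact: add_continuous. Qed.

Lemma measurable_sum_cond d (T : measurableType d) (R : realType) (I : Type)
    (r : seq I) (P : pred I) (h : I -> T -> R) :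
  (forall i, P i -> measurable_fun setT (h i)) ->
  measurable_fun setT (fun x => \sum_(i <- r | P i) h i x).
Proof.
move=> mh; under eq_fun do rewrite big_mkcond.
apply: measurable_sum => i; case: (boolP (P i)) => [/mh //|_].
exact: measurable_cst.
Qed.

(** * Reach-avoid probabilities under a fixed policy *)

Section ReachAvoid.
Context {R : realType} {S A : finType} {K : mdp_frame R S A}.
Implicit Types (ST SU : {set S}) (M : mdp K) (pi : policy K).

Lemma step_ge0 M pi s s' : 0 <= step M pi s s'.
Proof.
by apply: sumr_ge0 => a aK; rewrite mulr_ge0 ?pol_ge0 ?trans_ge0.
Qed.

Lemma step_sum1 M pi s : \sum_s' step M pi s s' = 1.
Proof.
rewrite exchange_big /= -[RHS](pol_sum1 pi s) [RHS](bigID (mem (avail K s))) /=.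
rewrite [X in _ + X]big1 ?addr0 => [|a aK]; last exact: pol_avail.
by apply: eq_bigr => a aK; rewrite -mulr_sumr trans_sum1 ?mulr1.
Qed.

Lemma path_prob_ge0 M pi s p : 0 <= path_prob M pi s p.
Proof.
by elim: p s => [|s' p IH] s /=; rewrite ?ler01 // mulr_ge0 ?step_ge0.
Qed.

Lemma path_prob_sum1 M pi n s :
  \sum_(t : n.-tuple S) path_prob M pi s t = 1.
Proof.
elim: n s => [|n IH] s.
  rewrite (eq_bigr (fun=> 1)) => [|t _]; last by rewrite [t]tuple0.
  by rewrite sumr_const card_tuple expn0.
rewrite big_tuple_cons -[RHS](step_sum1 M pi s).
by apply: eq_bigr => s' _; rewrite -mulr_sumr IH mulr1.
Qed.

Lemma reach_avoid_within_ge0 ST SU M pi n s :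
  0 <= reach_avoid_within ST SU M pi n s.
Proof. by apply: sumr_ge0 => t _; exact: path_prob_ge0. Qed.

(** The successful paths are among all [n]-step paths, whose total mass is 1. This bound makes
    [reach_avoid] and [mdp_V] suprema of bounded sets, so that [sup] has its intended value. *)
Lemma reach_avoid_within_le1 ST SU M pi n s :
  reach_avoid_within ST SU M pi n s <= 1.
Proof.
rewrite -(path_prob_sum1 M pi n s).
rewrite [leRHS](bigID (fun t => reach_avoid_path ST SU (s :: val t))) /=.
by rewrite lerDl sumr_ge0 // => t _; exact: path_prob_ge0.
Qed.

Lemma reach_avoid_within_le ST SU M pi n s :
  reach_avoid_within ST SU M pi n s <= reach_avoid ST SU M pi s.
Proof.
apply: ub_le_sup; last by exists n.
by exists 1 => _ [m _ <-]; exact: reach_avoid_within_le1.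
Qed.

Lemma reach_avoid_ge0 ST SU M pi s : 0 <= reach_avoid ST SU M pi s.
Proof.
apply: le_trans (reach_avoid_within_le _ _ _ _ 0 _).
exact: reach_avoid_within_ge0.
Qed.

Lemma reach_avoid_le1 ST SU M pi s : reach_avoid ST SU M pi s <= 1.
Proof.
apply: ge_sup; first by exists (reach_avoid_within ST SU M pi 0 s), 0%N.
by move=> _ [m _ <-]; exact: reach_avoid_within_le1.
Qed.

Lemma reach_avoid_le_mdp_V ST SU M pi s :
  reach_avoid ST SU M pi s <= mdp_V ST SU M s.
Proof.
apply: ub_le_sup; last by exists pi.
by exists 1 => _ [rho _ <-]; exact: reach_avoid_le1.
Qed.

(** * Rational policies and their density *)

Section WeightedPolicy.
Variable q : {ffun S -> {ffun A -> nat}}.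

(* The added 1 keeps the normaliser positive for every [q]. *)
Definition weight_prob (s : S) (a : A) : R :=
  if a \in avail K s then
    (q s a).+1%:R / \sum_(b in avail K s) (q s b).+1%:R else 0.

Let weight_gt0 s : 0 < \sum_(b in avail K s) (q s b).+1%:R :> R.
Proof.
have /set0Pn[a aK] := avail_neq0 K s.
by rewrite (bigD1 a) //= ltr_pwDl ?ltr0n ?sumr_ge0.
Qed.

Lemma weight_prob_ge0 s a : 0 <= weight_prob s a.
Proof. by rewrite /weight_prob; case: ifP => // _; rewrite divr_ge0 ?ltW. Qed.

Lemma weight_prob_sum1 s : \sum_a weight_prob s a = 1.
Proof. by rewrite -big_mkcond /= -mulr_suml divff // gt_eqF. Qed.

Lemma weight_prob_avail s a : a \notin avail K s -> weight_prob s a = 0.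
Proof. by rewrite /weight_prob => /negPf ->. Qed.

Definition weighted_policy : policy K :=
  Policy weight_prob_ge0 weight_prob_sum1 weight_prob_avail.

End WeightedPolicy.

(** Rounds [pi] to a grid of mesh 1/(n+1) and renormalises, which lands in the countable family
    [weighted_policy]. *)
Definition policy_approx pi (n : nat) : policy K :=
  weighted_policy [ffun s => [ffun a => Num.trunc (n.+1%:R * pol pi s a)]].

Lemma cvg_policy_approx pi s a :
  pol (policy_approx pi n) s a @[n --> \oo] --> pol pi s a.
Proof.
have [aK|aK] := boolP (a \in avail K s); last first.
  rewrite pol_avail //; under eq_fun do rewrite pol_avail //.
  exact: cvg_cst.
(* Weights divided by n+1, a factor that cancels in the normalised quotient. Since the weight is a
   truncation plus one, [w b n] lies between [pol pi s b] and [pol pi s b] + 1/(n+1). *)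
pose w (b : A) n : R := (Num.trunc (n.+1%:R * pol pi s b)).+1%:R / n.+1%:R.
have cvgw b : w b n @[n --> \oo] --> pol pi s b.
  apply: (@squeeze_cvgr _ _ _ _ (fun=> pol pi s b)
    (fun n => pol pi s b + harmonic n)); last 2 first.
  - exact: cvg_cst.
  - rewrite -[X in _ --> X]addr0; apply: cvgD; first exact: cvg_cst.
    exact: cvg_harmonic.
  near=> n; rewrite /w /harmonic /= ler_pdivlMr // ler_pdivrMr //.
  rewrite mulrDl mulVf // [_ * n.+1%:R]mulrC.
  have /truncn_itv/andP[tle /ltW ->] : 0 <= n.+1%:R * pol pi s b.
    by rewrite mulr_ge0 ?pol_ge0.
  by rewrite -natr1 lerD2r.
have sum1 : \sum_(b in avail K s) pol pi s b = 1.
  rewrite -[RHS](pol_sum1 pi s) [RHS](bigID (mem (avail K s))) /=.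
  by rewrite [X in _ + X]big1 ?addr0 // => b; exact: pol_avail.
(* The limit is written over the total mass 1 of the available actions, which is the limit of the
   denominators. *)
rewrite -[X in _ --> X](divr1 (pol pi s a)) -sum1.
have -> : (fun n => pol (policy_approx pi n) s a) =
    (fun n => w a n / \sum_(b in avail K s) w b n).
  apply/funext => n; rewrite /= /weight_prob aK /w -mulr_suml !ffunE.
  rewrite invfM invrK mulrACA mulVf // mulr1; congr (_ / _).
  by apply: eq_bigr => b _; rewrite !ffunE.
apply: cvgM => //; apply: cvgV; first by rewrite sum1 oner_neq0.
by apply: cvg_sum_cond => b _; exact: cvgw.
Unshelve. all: by end_near. Qed.

(** For a fixed horizon the value is a polynomial in the policy entries, so entrywise convergence
    suffices. *)
Lemma cvg_reach_avoid_within_approx ST SU M pi n s :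
  reach_avoid_within ST SU M (policy_approx pi k) n s @[k --> \oo] -->
  reach_avoid_within ST SU M pi n s.
Proof.
apply: cvg_sum_cond => t _.
elim: (tval t) s => [|s' p IH] s /=; first exact: cvg_cst.
apply: cvgM => //; apply: cvg_sum_cond => a _.
by apply: cvgMl; exact: cvg_policy_approx.
Qed.

(** A strict lower bound on a supremum is witnessed by some policy and horizon; being an open
    condition, it survives the passage to a close rational policy. The pairs [qn] are countable, so
    the superlevel sets of [mdp_V] become countable unions. *)
Lemma mdp_V_gtP ST SU M s c :
  c < mdp_V ST SU M s <->
  exists qn, c < reach_avoid_within ST SU M (weighted_policy qn.1) qn.2 s.
Proof.
split=> [|[[q n] /= h]]; last first.
  apply: (lt_le_trans h); apply: le_trans (reach_avoid_le_mdp_V _ _ _ _ _).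
  exact: reach_avoid_within_le.
have neq0 : range (fun pi => reach_avoid ST SU M pi s) !=set0.
  (* Zero weights give the uniform policy on available actions, a witness that policies exist. *)
  exists (reach_avoid ST SU M (weighted_policy [ffun=> [ffun=> 0%N]]) s).
  by eexists.
move=> /(sup_gt neq0)[_ [pi _ <-]].
have neq0' : range (fun n => reach_avoid_within ST SU M pi n s) !=set0.
  by exists (reach_avoid_within ST SU M pi 0 s), 0%N.
move=> /(sup_gt neq0')[_ [n _ <-]] clt.
have /cvgr_gt/(_ _ clt)[k _ /(_ k (leqnn k)) h] :=
  cvg_reach_avoid_within_approx ST SU M pi n s.
by exists ([ffun s => [ffun a => Num.trunc (k.+1%:R * pol pi s a)]], n).
Qed.

(** * Measurability for a random MDP *)

Section Measurability.
Variables (d : measure_display) (Omega : measurableType d) (M : Omega -> mdp K).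
Hypothesis mM : forall s a s', a \in avail K s ->
  measurable_fun setT (fun w => trans (M w) s a s').

Lemma measurable_reach_avoid_within ST SU pi n s :
  measurable_fun setT (fun w => reach_avoid_within ST SU (M w) pi n s).
Proof.
apply: measurable_sum_cond => t _.
elim: (tval t) s => [|s' p IH] s /=; first exact: measurable_cst.
apply: measurable_funM => //; apply: measurable_sum_cond => a aK.
by apply: measurable_funM; [exact: measurable_cst|exact: mM].
Qed.

Lemma measurable_mdp_V ST SU s :
  measurable_fun setT (fun w => mdp_V ST SU (M w) s).
Proof.
move=> mT; apply: (measurability _ (RGenOInfty.measurableE R)) => //.
move=> /= _ [_ [c ->] <-]; rewrite preimage_itvoy setTI.
rewrite [X in measurable X](_ : _ =
  \bigcup_(qn : {ffun S -> {ffun A -> nat}} * nat)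
  [set w | c < reach_avoid_within ST SU (M w) (weighted_policy qn.1) qn.2 s]).
  apply: countable_bigcupT_measurable; first exact: countableP.
  move=> qn; rewrite -[X in measurable X]setTI -preimage_itvoy.
  by apply: measurable_reach_avoid_within => //; exact: measurable_itv.
apply/seteqP; split=> w /=; first by move=> /mdp_V_gtP[qn h]; exists qn.
by move=> [qn _ h]; apply/mdp_V_gtP; exists qn.
Qed.

Lemma measurable_mdp_Q ST SU s a : a \in avail K s ->
  measurable_fun setT (fun w => mdp_Q ST SU (M w) s a).
Proof.
move=> aK; apply: measurable_sum_cond => s' _.
by apply: measurable_funM; [exact: mM|exact: measurable_mdp_V].
Qed.

Lemma measurable_mdp_Q_ge ST SU s a c : a \in avail K s ->
  measurable [set w | c <= mdp_Q ST SU (M w) s a].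
Proof.
move=> aK; rewrite -[X in measurable X]setTI -preimage_itvcy.
by apply: measurable_mdp_Q => //; exact: measurable_itv.
Qed.

Lemma measurable_in_imdp MI : measurable [set w | in_imdp MI (M w)].
Proof.
have -> : [set w | in_imdp MI (M w)] =
    \bigcap_(x in [set x : S * A * S |
      (x.1.2 \in avail K x.1.1) && (x.2 \in succ K x.1.1 x.1.2)])
    ((fun w => trans (M w) x.1.1 x.1.2 x.2) @^-1`
      `[lo MI x.1.1 x.1.2 x.2, up MI x.1.1 x.1.2 x.2]).
  apply/seteqP; split => [w h [[s a] s'] /= /andP[aK s'K]|w h s a s' aK s'K].
    by rewrite in_itv /=; exact: h.
  by have /= := h (s, a, s'); rewrite in_itv /= aK s'K; exact.
apply: fin_bigcap_measurable; first exact: finite_finset.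
move=> [[s a] s'] /= /andP[aK _]; rewrite -[X in measurable X]setTI.
by apply: mM => //; exact: measurable_itv.
Qed.

End Measurability.

Lemma mdp_dist_on M s a : a \in avail K s -> dist_on (succ K s a) (trans M s a).
Proof.
move=> aK; split; [by move=> s'; exact: trans_ge0|exact: trans_sum1|].
move=> s'; rewrite -(trans_succ M s' aK) -leNgt => le0.
by apply/eqP; rewrite eq_le le0 trans_ge0.
Qed.

(** * Robust values against the values of a member MDP *)

Section Robust.
Variables (ST SU : {set S}) (MI : imdp K) (V : S -> R) (M : mdp K).
Hypotheses (hV : imdp_V_spec ST SU MI V) (hM : in_imdp MI M).

Let worst pi s := inf [set reach_avoid ST SU M' pi s | M' in in_imdp MI].

Let worst_le pi s : worst pi s <= mdp_V ST SU M s.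
Proof.
apply: le_trans (reach_avoid_le_mdp_V ST SU M pi s).
apply: ge_inf; last by exists M.
by exists 0 => _ [M' _ <-]; exact: reach_avoid_ge0.
Qed.

(** The max-min clause of [imdp_V_spec] reduces this to a bound for each policy separately. *)
Lemma imdp_V_le_mdp_V s : V s <= mdp_V ST SU M s.
Proof.
have [_ _ _ ->] := hV; apply: ge_sup => [|_ [pi _ <-]]; last exact: worst_le.
by exists (worst (weighted_policy [ffun=> [ffun=> 0%N]]) s); eexists.
Qed.

(** Ensures that the set whose infimum is [imdp_Q] is bounded below, so that [inf] is a true lower
    bound. *)
Lemma imdp_V_ge0 s : 0 <= V s.
Proof.
have [_ _ _ ->] := hV.
pose pi := weighted_policy [ffun=> [ffun=> 0%N]].
apply: (@le_trans _ _ (worst pi s)).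
  apply: lb_le_inf; first by exists (reach_avoid ST SU M pi s), M.
  by move=> _ [M' _ <-]; exact: reach_avoid_ge0.
apply: ub_le_sup; last by exists pi.
by exists (mdp_V ST SU M s) => _ [rho _ <-]; exact: worst_le.
Qed.

Lemma imdp_Q_le_mdp_Q s a : a \in avail K s ->
  imdp_Q MI V s a <= mdp_Q ST SU M s a.
Proof.
(* The intermediate term takes the transitions of [M] with the robust values: first the distribution
   is changed, then the value function. *)
move=> aK; apply: (@le_trans _ _ (\sum_s' trans M s a s' * V s')).
  apply: ge_inf.
    exists 0 => _ [p [[p0 _ _] _] <-].
    by apply: sumr_ge0 => s' _; rewrite mulr_ge0 ?imdp_V_ge0.
  exists (trans M s a) => //; split; first exact: mdp_dist_on.
  by move=> s'; exact: hM.
by apply: ler_sum => s' _; rewrite ler_wpM2l ?imdp_V_le_mdp_V ?trans_ge0.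
Qed.

Lemma shield_mdp_Q theta s a : a \in shield MI V theta s ->
  1 - theta <= mdp_Q ST SU M s a.
Proof.
by rewrite inE => /andP[aK /ltW h]; apply: (le_trans h); exact: imdp_Q_le_mdp_Q.
Qed.

End Robust.

End ReachAvoid.

(** * Events depending on the dataset, and their probabilities *)

Lemma measurable_countable_fibers d (Omega : measurableType d) (T : countType)
    (X : Omega -> T) (E : T -> set Omega) :
  (forall x, measurable (X @^-1` [set x])) ->
  (forall x, measurable (E x)) ->
  measurable [set w | E (X w) w].
Proof.
move=> mX mE; have -> : [set w | E (X w) w] =
    \bigcup_x (X @^-1` [set x] `&` E x).
  apply/seteqP; split=> w /=; first by exists (X w).
  by move=> [x _ [/= ->]].
apply: countable_bigcupT_measurable; first exact: countableP.
by move=> x; exact: measurableI.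
Qed.

Theorem theorem1 (R : realType) (S A : finType) (K : mdp_frame R S A)
  (* target and unsafe states *)
  (ST SU : {set S}) (hdisj : [disjoint ST & SU]%B)
  (* probability space carrying the true MDP and the dataset *)
  (d : measure_display) (Omega : measurableType d) (P : probability Omega R)
  (Mstar : Omega -> mdp K)
  (hMstar : forall s a s', a \in avail K s ->
     measurable_fun setT (fun w => trans (Mstar w) s a s'))
  (D : Omega -> dataset S A)
  (hD : forall D0 : dataset S A, measurable (D @^-1` [set D0]))
  (hDvalid : forall w, data_valid K (D w))
  (* point estimate, interval parameters and estimated IMDP *)
  (alpha : S -> A -> S -> R) (halpha : forall s a s', 1 <= alpha s a s')
  (That : dataset S A -> S -> A -> S -> R)
  (hThat : forall D0 s a, a \in avail K s ->
     dirichlet_mode (succ K s a) (posterior alpha D0 s a) (That D0 s a))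
  (deltaI : R) (hdeltaI : 0 <= deltaI <= 1)
  (xi : R) (hxi : 0 < xi < 1)
  (Mhat : dataset S A -> imdp K)
  (hMhat : forall D0, Mhat D0 = est_imdp K deltaI xi (That D0) D0)
  (* guarantee of the estimated IMDP *)
  (hguarantee : ((1 - deltaI)%:E <=
     P [set w | in_imdp (Mhat (D w)) (Mstar w)])%E)
  (* optimal worst-case values of the estimated IMDP *)
  (V : dataset S A -> S -> R)
  (hV : forall w, (exists M, in_imdp (Mhat (D w)) M) ->
     imdp_V_spec ST SU (Mhat (D w)) (V (D w)))
  (* threshold, possibly chosen after the data have been seen *)
  (theta : dataset S A -> R)
  (htheta : forall D0, 0 <= theta D0 <= 1)
  (hfeasible : forall w,
     feasible ST SU (Mhat (D w)) (V (D w)) (theta (D w))) :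
  ((1 - deltaI)%:E <=
     P [set w | forall s a,
          a \in shield (Mhat (D w)) (V (D w)) (theta (D w)) s ->
          (1 - theta (D w) <= mdp_Q ST SU (Mstar w) s a)%R])%E
  /\
  (forall (s : S) (act : Omega -> A),
     (forall a, measurable (act @^-1` [set a])) ->
     (forall w, act w \in shield (Mhat (D w)) (V (D w)) (theta (D w)) s) ->
     ((1 - deltaI)%:E <=
        P [set w | (1 - theta (D w) <= mdp_Q ST SU (Mstar w) s (act w))%R])%E).
Proof.
(* Datasets form a countable type, so measurability can be checked with the dataset frozen, however
   the estimate, values and threshold depend on it. *)
have mE : measurable [set w | in_imdp (Mhat (D w)) (Mstar w)].
  apply: (@measurable_countable_fibers _ _ (dataset S A) D
    (fun D0 => [set w | in_imdp (Mhat D0) (Mstar w)])) => // D0.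
  exact: measurable_in_imdp.
have shield_avail D0 s a :
    a \in shield (Mhat D0) (V D0) (theta D0) s -> a \in avail K s.
  by rewrite inE => /andP[].
have safe w s a : in_imdp (Mhat (D w)) (Mstar w) ->
    a \in shield (Mhat (D w)) (V (D w)) (theta (D w)) s ->
    1 - theta (D w) <= mdp_Q ST SU (Mstar w) s a.
  move=> h; apply: shield_mdp_Q => //.
  (* On the good event the true MDP itself shows that the interval MDP is inhabited, as [hV]
     requires. *)
  by apply: hV; exists (Mstar w).
split=> [|s act mact hact].
  apply: (le_trans hguarantee); apply: le_measure; rewrite ?inE //; last first.
    by move=> w /= h s a; exact: safe.
  apply: (@measurable_countable_fibers _ _ (dataset S A) D
    (fun D0 => [set w | forall s a, a \in shield (Mhat D0) (V D0) (theta D0) s ->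
       1 - theta D0 <= mdp_Q ST SU (Mstar w) s a])) => // D0.
  (* With the dataset frozen, the shield is a fixed finite set of pairs, so the event is a finite
     intersection. *)
  have -> : [set w | forall s a, a \in shield (Mhat D0) (V D0) (theta D0) s ->
       1 - theta D0 <= mdp_Q ST SU (Mstar w) s a] =
    \bigcap_(x in [set x : S * A |
        x.2 \in shield (Mhat D0) (V D0) (theta D0) x.1])
      [set w | 1 - theta D0 <= mdp_Q ST SU (Mstar w) x.1 x.2].
    apply/seteqP; split=> w h; first by move=> [s a] /=; exact: h.
    by move=> s a sa; exact: (h (s, a)).
  apply: fin_bigcap_measurable; first exact: finite_finset.
  by move=> [s a] /= /shield_avail; exact: measurable_mdp_Q_ge.
apply: (le_trans hguarantee); apply: le_measure; rewrite ?inE //; last first.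
  by move=> w /= h; exact: safe.
(* Availability is recorded in the event because, once the action is frozen to an arbitrary [a],
   measurability of [trans] is known only for available actions; for the others the event is now
   empty. *)
have -> : [set w | 1 - theta (D w) <= mdp_Q ST SU (Mstar w) s (act w)] =
    [set w | act w \in avail K s /\
       1 - theta (D w) <= mdp_Q ST SU (Mstar w) s (act w)].
  apply/seteqP; split=> w /=; last by case.
  by split=> //; exact: shield_avail (hact w).
apply: (@measurable_countable_fibers _ _ (dataset S A) D
  (fun D0 => [set w | act w \in avail K s /\
     1 - theta D0 <= mdp_Q ST SU (Mstar w) s (act w)])) => // D0.
apply: (@measurable_countable_fibers _ _ A act
  (fun a => [set w | a \in avail K s /\
     1 - theta D0 <= mdp_Q ST SU (Mstar w) s a])) => // a.
have [aK|aK] := boolP (a \in avail K s); last first.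
  by rewrite [X in measurable X](_ : _ = set0) // -subset0 => w [].
rewrite [X in measurable X](_ : _ =
    [set w | 1 - theta D0 <= mdp_Q ST SU (Mstar w) s a]).
  exact: measurable_mdp_Q_ge.
by apply/seteqP; split=> w //= [].
Qed.
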